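(* Let $n$ be a positive integer and let $\Gamma=C_\infty\cdot K_n$ (vertices $v_{ij}$, $i\in\mathbb Z$, $1\le j\le n$, with $v_{ij}$ adjacent to $v_{i'j'}$ iff $|i-i'|=1$, or $i=i'$ and $j\ne j'$). Every perfect coloring $\psi$ of $\Gamma$ with a finite set of colors is either disjunctive, or non-disjunctive and $3$-periodic, i.e. for every $i\in\mathbb Z$ the multiset of colors of block $V_i$ equals the multiset of colors of block $V_{i+3}$.
   Context: $C_\infty$ is the graph on $\mathbb Z$ with $u\sim v$ iff $|u-v|=1$; $K_n$ is the complete graph on $n$ vertices; $C_\infty\cdot K_n$ is their lexicographic product. The $i$-th block is $V_i=\{v_{i1},\dots,v_{in}\}$. A coloring with finitely many colors is perfect if there is a matrix $(m_{ab})$ such that every vertex of color $a$ has exactly $m_{ab}$ neighbours of color $b$. A coloring $\psi$ of $\Gamma$ is disjunctive if there are a perfect coloring $\chi:\mathbb Z\to\{1,\dots,k\}$ of $C_\infty$ and maps $\phi_1,\dots,\phi_k:\{1,\dots,n\}\to J_1,\dots,J_k$ with pairwise disjoint color sets $J_1,\dots,J_k$ such that $\psi(v_{ij})=\phi_{\chi(i)}(j)$.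
   Formalization: ''Disjunctive'' is taken up to renumbering the vertices inside each block V_i (ψ(v_ij)=φ_χ(i)(j) after a permutation of each block); with the fixed numbering the claim fails for n ≥ 2. *)

(* Defs.v *)
From HB Require Import structures.
From mathcomp Require Import all_boot all_order all_algebra all_fingroup.
From mathcomp Require Import classical_sets functions cardinality.
Set Implicit Arguments.
Unset Strict Implicit.
Unset Printing Implicit Defensive.
Import Order.TTheory GRing.Theory Num.Theory.
Local Open Scope classical_set_scope.
Local Open Scope card_scope.
Local Open Scope ring_scope.

Definition Cinf : rel int := fun u v => `|u - v| == 1.

Definition Kn (n : nat) : rel 'I_n := fun i j => i != j.

Definition lexprod (V W : eqType) (e : rel V) (f : rel W) : rel (V * W) :=
  fun x y => e x.1 y.1 || (x.1 == y.1) && f x.2 y.2.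

(* [A #= `I_m] says that A has exactly m elements. The rows of m indexed by
   colors that psi does not use are unconstrained. *)
Definition perfect (V : Type) (C : finType) (e : rel V) (psi : V -> C) : Prop :=
  exists m : C -> C -> nat, forall (v : V) (b : C),
    [set u | e v u /\ psi u = b] #= `I_(m (psi v) b).

Definition disjunctive_numbered (n : nat) (C : finType)
    (psi : int * 'I_n -> C) : Prop :=
  exists (k : nat) (chi : int -> 'I_k) (J : 'I_k -> set C)
         (phi : 'I_k -> 'I_n -> C),
    [/\ perfect Cinf chi,
        trivIset [set: 'I_k] J,
        forall a j, J a (phi a j)
      & forall i j, psi (i, j) = phi (chi i) j].

(* The numbering of the vertices inside a block is arbitrary: psi is
   disjunctive when it has the form above for a suitable choice of numbering
   s i of each block. With one fixed numbering the notion would not be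
   invariant under the automorphisms of the graph that permute a block. *)
Definition disjunctive (n : nat) (C : finType) (psi : int * 'I_n -> C) : Prop :=
  exists s : int -> {perm 'I_n},
    disjunctive_numbered (fun v : int * 'I_n => psi (v.1, s v.1 v.2)).

Definition block (n : nat) (C : finType) (psi : int * 'I_n -> C) (i : int) :
    seq C :=
  [seq psi (i, j) | j : 'I_n].

(* perm_eq is equality of multisets. *)
Definition three_periodic (n : nat) (C : finType) (psi : int * 'I_n -> C) :
    Prop :=
  forall i : int, perm_eq (block psi i) (block psi (i + 3)).

(* Main.v *)
(* Call the window of a block the sum of the color multisets of the block and of
   its two neighbours. Perfectness says that two blocks sharing a color have the
   same window; calling the window of a block its type, blocks of different types
   have disjoint color sets, and the type of a block determines the part of its
   window lying in blocks of any given type, in particular how many of these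
   blocks there are. If blocks of equal type are always equal, the coloring is
   disjunctive. Otherwise let t be the type of two different blocks, and count
   the blocks of type t in the window of a block of type t. One is impossible.
   If there are three, all blocks have type t. If there are two, the remaining
   neighbour has another type r; a block of type r has two neighbours of type t,
   since otherwise its window would determine its only neighbour of type t, and
   so the types read ... r t t r t t .... In the last two cases windows are
   3-periodic, and so are the differences of blocks three apart; as blocks are
   bounded, these differences vanish. *)
Require Import Defs.
From HB Require Import structures.
From mathcomp Require Import all_boot all_order all_algebra all_fingroup.
From mathcomp Require Import classical_sets functions cardinality.
From mathcomp Require Import boolp zify ring finmap.
Set Implicit Arguments.
Unset Strict Implicit.
Unset Printing Implicit Defensive.
Import Order.TTheory GRing.Theory Num.Theory.
Local Open Scope ring_scope.

Lemma int_connected (P : int -> Prop) (i : int) :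
  P i -> (forall j, P j -> P (j - 1) /\ P (j + 1)) -> forall j, P j.
Proof.
move=> Pi step j; rewrite -(subrK i j) addrC; move: (j - i).
elim/int_rec=> [|m IH|m IH]; first by rewrite addr0.
  by have [_] := step _ IH; rewrite intS [1 + _]addrC addrA.
by have [] := step _ IH; rewrite intS opprD [- 1 + _]addrC addrA.
Qed.

(** * Integer-indexed sequences of multisets of size [n], and their windows *)

Section Types.

Variables (C : finType) (n : nat) (x : int -> {ffun C -> nat}).
Hypothesis sum_x : forall i, (\sum_b x i b = n)%N.

Definition window (i : int) : {ffun C -> nat} :=
  [ffun b => (x (i - 1) b + x i b + x (i + 1) b)%N].

Lemma periodic_of_window :
  (forall i, window i = window (i + 3)) -> forall i, x i = x (i + 3).
Proof.
move=> w3 i; apply/ffunP => b.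
have bound j : (x j b <= n)%N by rewrite -(sum_x j) (bigD1 b) //= leq_addr.
pose D j : int := (x (j + 3) b)%:Z - (x j b)%:Z.
have D_window j : D j = (window (j + 1 + 1) b)%:Z - (window (j + 1) b)%:Z.
  rewrite !ffunE !addrK /D.
  have -> : j + 1 + 1 + 1 = j + 3 by lia.
  by rewrite !PoszD; ring.
have D3 j : D (j + 3) = D j.
  by rewrite !D_window ![j + 3 + _]addrAC -[j + 1 + 3 + 1]addrAC -!w3.
have lin (m : nat) :
    (x (i + 3 * m%:Z) b)%:Z = (x i b)%:Z + m%:Z * D i /\ D (i + 3 * m%:Z) = D i.
  elim: m => [|m [IHx IHD]]; first by rewrite mulr0 mul0r !addr0.
  have -> : i + 3 * m.+1%:Z = i + 3 * m%:Z + 3 by lia.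
  rewrite D3 IHD; split=> //; move: IHD; rewrite {1}/D IHx intS.
  by move/(canRL (subrK _)) ->; ring.
(* A nonzero [D i] would change the multiplicity by at least [n + 1] over [n + 1] jumps of length
   three, but multiplicities lie between 0 and [n]. *)
have [] := lin n.+1; have := bound (i + 3 * n.+1%:Z); have := bound i; rewrite /D.
move: (x _ b) (x i b) (x (i + 3) b) => p q r; nia.
Qed.

Hypothesis n_gt0 : (0 < n)%N.

Hypothesis window_shared : forall i j b,
  (0 < x i b)%N -> (0 < x j b)%N -> window i = window j.

(** A type is named by any block [k] that has it, here and in [part]. *)
Definition occ (k i : int) : nat :=
  (window (i - 1) == window k) + (window i == window k)
  + (window (i + 1) == window k).

Definition part (k i : int) (b : C) : nat :=
  ((window (i - 1) == window k) * x (i - 1) b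
   + (window i == window k) * x i b
   + (window (i + 1) == window k) * x (i + 1) b)%N.

(* A color determines the window of the blocks containing it, so the restriction
   of a window to the blocks of one type is its restriction to a set of colors. *)
Lemma part_eq k i j b : window i = window j -> part k i b = part k j b.
Proof.
move=> eq_ij.
have [[l lk lb]|none] :=
  EM (exists2 l, window l = window k & (0 < x l b)%N).
  have keep p : ((window p == window k) * x p b)%N = x p b.
    have [->|xp] := posnP (x p b); first by rewrite muln0.
    by rewrite (window_shared xp lb) lk eqxx mul1n.
  by move/ffunP/(_ b): eq_ij; rewrite /part !keep !ffunE.
have drop p : ((window p == window k) * x p b)%N = 0%N.
  case: eqP => // pk; rewrite mul1n; apply/eqP; rewrite -leqn0 leqNgt.
  by apply/negP => xp; apply: none; exists p.
by rewrite /part !drop.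
Qed.

(** Every block has total [n], so summing [part] over all colors gives [n] times [occ], and
    [part_eq] applies. *)
Lemma occ_eq k i j : window i = window j -> occ k i = occ k j.
Proof.
move=> eq_ij; apply/eqP; rewrite -(eqn_pmul2r n_gt0); apply/eqP.
suff sum_part l : (\sum_b part k l b = occ k l * n)%N.
  by rewrite -!sum_part; apply: eq_bigr => b _; apply: part_eq.
rewrite /part /occ !big_split /= !mulnDl.
by rewrite -!big_distrr /= !sum_x.
Qed.

Lemma window_dichotomy :
  (forall i, window i = window (i + 3)) \/
  (forall i j, window i = window j -> x i = x j).
Proof.
have [?|] := EM (forall i j, window i = window j -> x i = x j);
  [by right | left].
move/existsNP: b => [i /existsNP [j /not_implyP [w_ij x_ij]]].
have occ_i p : window p = window i -> occ i p = occ i i by exact: occ_eq.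
have part_i p : window p = window i -> part i p =1 part i i.
  by move=> w_p b; apply: part_eq.
have [occ1|occ1] := eqVneq (occ i i) 1%N.
  (* Here a block is the whole part of its own type in its window, so equal types force equal
     blocks. *)
  have alone p : window p = window i -> part i i =1 x p.
    move=> w_p b; rewrite -(part_i p) //.
    have := occ_i p w_p; rewrite occ1 /occ /part w_p eqxx.
    by do 2![case: eqP => _ //]; rewrite !mul0n mul1n addn0.
  by case: x_ij; apply/ffunP => b; rewrite -(alone i) // -(alone j).
have [occ3|occ3] := eqVneq (occ i i) 3.
  have all_i : forall p, window p = window i.
    apply: (int_connected (i := i)) => // p w_p.
    have := occ_i p w_p; rewrite occ3 /occ.
    by do 3!case: eqP.
  by move=> p; rewrite !all_i.
have occ2 : occ i i = 2.
  by move: occ1 occ3; rewrite /occ eqxx; lia.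
have [q [iq w_q]] : exists q, (i = q + 1 \/ i = q - 1) /\ window q <> window i.
  have := occ2; rewrite /occ eqxx.
  case: eqP => [_|w_q _]; last by exists (i - 1); split=> //; left; rewrite subrK.
  case: eqP => [_|w_q _] //; by exists (i + 1); split=> //; right; rewrite addrK.
have occ_q_i : occ q i = 1%N.
  have := occ2; rewrite /occ eqxx (_ : (window i == window q) = false); last first.
    by apply/eqP => w_i; apply: w_q.
  case: iq w_q => ->; rewrite ?addrK ?subrK eqxx => w_q; rewrite (introF eqP w_q);
    by case: eqP => // ->; rewrite eq_sym (introF eqP w_q).
have occ_i_p p : window p = window i ->
    ((window (p - 1) == window i) + (window (p + 1) == window i) = 1)%N.
  by move=> w_p; have := occ_i p w_p; rewrite occ2 /occ w_p eqxx; lia.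
have occ_q_p p : window p = window i ->
    ((window (p - 1) == window q) + (window (p + 1) == window q) = 1)%N.
  move=> w_p; have := occ_eq q w_p; rewrite occ_q_i /occ w_p.
  by case: (window i =P window q) => [w_i|_]; [case: w_q | rewrite addn0].
have [occ_iq|occ_iq] := eqVneq (occ i q) 1%N.
  (* A block [p] of type [i] has a neighbour [r] of type [q]. Now [p] is the only block of type [i]
     in the window of [r], so the type of [r] determines [p]. *)
  have same p : window p = window i -> x p =1 part i q.
    move=> w_p b.
    have [r pr w_r] : exists2 r, p = r + 1 \/ p = r - 1 & window r = window q.
      have := occ_q_p p w_p; case: eqP => [w_r _|_].
        by exists (p - 1) => //; left; rewrite subrK.
      by case: eqP => // w_r _; exists (p + 1) => //; right; rewrite addrK.
    rewrite -(part_eq i b w_r); have := occ_eq i w_r.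
    rewrite occ_iq /occ /part w_r.
    rewrite (introF eqP w_q); case: pr w_p => -> ->; rewrite eqxx.
      by case: eqP => // _ _; rewrite !mul0n mul1n.
    by case: eqP => // _ _; rewrite !mul0n mul1n !addn0.
  by case: x_ij; apply/ffunP => b; rewrite (same i) // (same j).
have two r : window r = window q ->
    window (r - 1) = window i /\ window (r + 1) = window i.
  move=> w_r; move: occ_iq; rewrite -(occ_eq i w_r).
  (* The blocks [q] and [i] are adjacent, and the central block [r] does not have type [i]; a
     nonzero count other than one must be two. *)
  have : (0 < occ i q)%N.
    rewrite /occ; case: iq => <-; rewrite eqxx; lia.
  rewrite -(occ_eq i w_r) /occ w_r (introF eqP w_q).
  by do 2![case: (_ =P window i) => ?].
have iq_all : forall p, window p = window i \/ window p = window q.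
  apply: (int_connected (i := i)) => [|p [w_p|/two [-> ->]]];
    [by left| |by split; left].
  have := occ_i_p p w_p; have := occ_q_p p w_p.
  case: (window (p - 1) =P window i) => [->|_].
    rewrite (introF eqP (nesym w_q)).
    by case: (window (p + 1) =P window q) => [->|]; auto.
  case: (window (p + 1) =P window i) => // ->.
  rewrite (introF eqP (nesym w_q)).
  by case: (window (p - 1) =P window q) => [->|]; auto.
have one p : ((window (p - 1) == window q) + (window p == window q)
              + (window (p + 1) == window q) = 1)%N.
  have [w_p|w_p] := iq_all p.
    by have := occ_q_p p w_p; rewrite w_p (introF eqP (nesym w_q)) addn0.
  by have [-> ->] := two p w_p; rewrite w_p eqxx (introF eqP (nesym w_q)).
(* The triples starting at [p] and [p + 1] share two blocks and each contain exactly one of type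
   [q], so [p] and [p + 3] have the same type. *)
move=> p; have := one (p + 1); have := one (p + 1 + 1).
rewrite !addrK (_ : p + 1 + 1 + 1 = p + 3); last by lia.
have [-> | ->] := iq_all p; have [-> | ->] := iq_all (p + 3) => //;
  by rewrite eqxx (introF eqP (nesym w_q));
     case: (_ (p + 1) == _); case: (_ (p + 1 + 1) == _).
Qed.

End Types.

Lemma card_eq_seq (T : choiceType) (A : set T) (s : seq T) :
  uniq s -> (forall u, A u <-> u \in s) -> (A #= `I_(size s))%card.
Proof.
move=> s_uniq As; have -> : A = [set` [fset u in s]%fset]%classic.
  by apply/seteqP; split=> u /=; rewrite inE => /As.
by apply/card_eq_fsetP; rewrite card_fseq undup_id.
Qed.

Lemma Cinf_near (u v : int) : Cinf u v = (v == u - 1) || (v == u + 1).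
Proof. by rewrite /Cinf; lia. Qed.

(** * Color multisets of the blocks of a perfect coloring *)

Section Blocks.

Variables (n : nat) (C : finType) (psi : int * 'I_n -> C).
Hypothesis psi_perfect : perfect (lexprod Cinf (@Kn n)) psi.

Definition mult (i : int) : {ffun C -> nat} :=
  [ffun b => count_mem b (block psi i)].

Lemma multE i b : mult i b = #|[pred l | psi (i, l) == b]|.
Proof. by rewrite ffunE /block count_map cardE -size_filter enumT. Qed.

Lemma mult_gt0 i b : reflect (exists l, psi (i, l) = b) (0 < mult i b)%N.
Proof.
by rewrite multE; apply: (iffP card_gt0P) => -[l /eqP]; exists l => //; apply/eqP.
Qed.

Lemma sum_mult i : (\sum_b mult i b = n)%N.
Proof.
under eq_bigr do rewrite multE -sum1_card.
rewrite -[RHS]card_ord -sum1_card (partition_big (fun l => psi (i, l)) predT) //=.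
Qed.

Lemma perm_eq_mult i j : mult i = mult j -> perm_eq (block psi i) (block psi j).
Proof.
by move=> eq_ij; apply/allP => b _ /=; move/ffunP/(_ b): eq_ij; rewrite !ffunE => ->.
Qed.

(** The blocks [k - 1], [k], [k + 1] form the closed neighbourhood of each vertex of block [k], so
    the window is the matrix row of that vertex's color plus one for the vertex itself. *)
Lemma window_mult_shared i j b :
  (0 < mult i b)%N -> (0 < mult j b)%N -> window mult i = window mult j.
Proof.
have [m psi_m] := psi_perfect.
suff windowE k l c : window mult k c = (m (psi (k, l)) c + (psi (k, l) == c))%N.
  move=> /mult_gt0[l psi_l] /mult_gt0[l' psi_l']; apply/ffunP => c.
  by rewrite (windowE i l) (windowE j l') psi_l psi_l'.
pose L := [seq (k', l') | k' <- [:: k - 1; k; k + 1], l' <- enum 'I_n].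
pose s := [seq u <- L | lexprod Cinf (@Kn n) (k, l) u && (psi u == c)].
have s_uniq : uniq s.
  rewrite filter_uniq // allpairs_uniq ?enum_uniq //; first by rewrite /= !inE; lia.
  by move=> [a b'] [a' b''].
have /(card_eq_seq s_uniq) : forall u,
    (lexprod Cinf (@Kn n) (k, l) u /\ psi u = c) <-> u \in s.
  move=> [k' l']; rewrite mem_filter; split=> [[adj <-]|/andP[/andP[-> /eqP]] //].
  rewrite adj eqxx; apply/allpairsP; exists (k', l'); split; rewrite ?mem_enum //=.
  by move: adj; rewrite /lexprod /= Cinf_near !inE; lia.
rewrite card_eq_sym => /card_eq_trans/(_ (psi_m (k, l) c))/card_eq_II => <-.
have countE k' : count [pred u | lexprod Cinf (@Kn n) (k, l) u && (psi u == c)]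
    [seq (k', l') | l' <- enum 'I_n]
    = #|[pred l' | lexprod Cinf (@Kn n) (k, l) (k', l') && (psi (k', l') == c)]|.
  by rewrite count_map cardE -size_filter enumT.
rewrite size_filter /L /= !count_cat !countE /= addn0 ffunE !multE.
rewrite [in LHS](cardD1 l [pred l' | psi (k, l') == c]) inE.
have -> : #|[pred l' | lexprod Cinf (@Kn n) (k, l) (k - 1, l')
                    && (psi (k - 1, l') == c)]|
    = #|[pred l' | psi (k - 1, l') == c]|.
  by apply: eq_card => l'; rewrite !inE /lexprod /= Cinf_near eqxx.
have -> : #|[pred l' | lexprod Cinf (@Kn n) (k, l) (k + 1, l')
                    && (psi (k + 1, l') == c)]|
    = #|[pred l' | psi (k + 1, l') == c]|.
  by apply: eq_card => l'; rewrite !inE /lexprod /= Cinf_near eqxx orbT.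
have -> : #|[pred l' | lexprod Cinf (@Kn n) (k, l) (k, l')
                    && (psi (k, l') == c)]|
    = #|[predD1 [pred l' | psi (k, l') == c] & l]|.
  apply: eq_card => l'; rewrite !inE /lexprod /=.
  rewrite Cinf_near eqxx /Kn [l == _]eq_sym.
  by have -> : (k == k - 1) || (k == k + 1) = false by lia.
ring.
Qed.

Hypothesis n_gt0 : (0 < n)%N.

(** Types become the colors of [chi]; permuting each block makes it agree with a chosen
    representative of its type. *)
Lemma disjunctive_of_window :
  (forall i j, window mult i = window mult j -> mult i = mult j) ->
  disjunctive psi.
Proof.
move=> mult_window.
pose supp i := [set c | 0 < mult i c]%N.
have window_supp i j c :
    c \in supp i -> c \in supp j -> window mult i = window mult j.
  by rewrite !inE; apply: window_mult_shared.
have in_supp i l : psi (i, l) \in supp i by rewrite inE; apply/mult_gt0; exists l.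
have supp_window i j : supp i = supp j <-> window mult i = window mult j.
  split=> [eq_ij|/mult_window eq_ij]; last by rewrite /supp eq_ij.
  by apply: (window_supp _ _ _ (in_supp i (Ordinal n_gt0))); rewrite -eq_ij.
(* By [supp_window] a type amounts to a color set; color sets, unlike windows, live in a finite type
   and can be numbered. *)
pose U := [set A | `[< exists i, supp i = A >]].
have supp_U i : supp i \in U by rewrite inE; apply/asboolP; exists i.
pose chi i := enum_rank_in (supp_U 0) (supp i).
have chiK i : enum_val (chi i) = supp i by apply: enum_rankK_in.
have chi_window i j : chi i = chi j <-> window mult i = window mult j.
  rewrite -supp_window -!chiK; split=> [->//|]; exact: enum_val_inj.
have /choice[rep chi_rep] (a : 'I_#|U|) : exists i, chi i = a.
  have := enum_valP a; rewrite inE => /asboolP[i supp_i]; exists i.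
  by apply: enum_val_inj; rewrite chiK.
have /choice[s psi_s] i : exists s : {perm 'I_n},
    forall l, psi (i, s l) = psi (rep (chi i), l).
  have /mult_window eq_mult : window mult (rep (chi i)) = window mult i.
    by apply/chi_window; rewrite chi_rep.
  have /tuple_permP[s block_s] : perm_eq (block psi (rep (chi i)))
      [tuple psi (i, l) | l < n].
    by rewrite (perm_trans (perm_eq_mult eq_mult)) //= perm_refl.
  exists s => l; have /eq_in_map/(_ l) := block_s.
  by rewrite mem_enum tnth_mktuple => ->.
exists s, #|U|, chi, (fun a : 'I_#|U| => [set c | c \in (enum_val a : {set C})]%classic),
  (fun a l => psi (rep a, l)).
split.
(* The matrix is read off at the representatives. Since [occ] also counts the central block,
   [occ_eq] gives the entry once [chi i == b] is cancelled. *)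
- exists (fun a b => (chi (rep a - 1)%R == b) + (chi (rep a + 1)%R == b))%N => i b.
  pose nbrs j := [seq u <- [:: j - 1; j + 1] | chi u == b].
  have occE j : occ mult (rep b) j = (size (nbrs j) + (chi j == b))%N.
    have eqE u : (window mult u == window mult (rep b)) = (chi u == b).
      by rewrite -{2}(chi_rep b); apply/eqP/eqP => /chi_window.
    by rewrite /occ !eqE size_filter /= addn0 addnAC.
  have -> : ((chi (rep (chi i) - 1)%R == b) + (chi (rep (chi i) + 1)%R == b))%N
      = size (nbrs i).
    apply/eqP; rewrite -(eqn_add2r (chi i == b)) -occE.
    have /(occ_eq sum_mult n_gt0 window_mult_shared (rep b)) <- :
        window mult (rep (chi i)) = window mult i.
      by apply/chi_window; rewrite chi_rep.
    by rewrite occE chi_rep size_filter /= addn0.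
  apply: card_eq_seq => [|u]; first by rewrite filter_uniq //= !inE; lia.
  rewrite mem_filter !inE -Cinf_near; split=> [[-> ->]|/andP[/eqP]] //.
  by rewrite eqxx.
- apply/trivIsetP => a b _ _ /eqP ab; rewrite -subset0 => c [/=].
  rewrite -(chi_rep a) -(chi_rep b) !chiK => ca cb; apply: ab.
  by rewrite -(chi_rep a) -(chi_rep b); apply/chi_window/(window_supp _ _ c).
- by move=> a l /=; rewrite -{2}(chi_rep a) chiK in_supp.
- by move=> i l; rewrite psi_s.
Qed.

End Blocks.

Theorem theorem2 (n : nat) (C : finType) (psi : int * 'I_n -> C)
  (n_gt0 : (0 < n)%N) (psi_perfect : perfect (lexprod Cinf (@Kn n)) psi) :
  disjunctive psi \/ (~ disjunctive psi /\ three_periodic psi).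
Proof.
have [?|not_disj] := EM (disjunctive psi); [by left | right; split=> //].
have shared := window_mult_shared psi_perfect.
have [w3|sep] := window_dichotomy (sum_mult psi) n_gt0 shared.
  by move=> i; apply/perm_eq_mult/(periodic_of_window (sum_mult psi) w3).
by case: not_disj; apply: disjunctive_of_window.
Qed.
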